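(* Let $d\ge 1$ and let $0=\ell_0<\ell_1<\cdots<\ell_d$ be integers. Let $C_{\ell,d}^{(2)}\subset\mathbb{R}^2$ be the convex hull of the points $(\ell_i,\ell_i^2)$, $i=0,\dots,d$. The lattice volume of $C_{\ell,d}^{(2)}$ and the number $i(C_{\ell,d}^{(2)})$ of lattice points in $C_{\ell,d}^{(2)}$ are given as \[\mathrm{Vol}\, C_{\ell,d}^{(2)}=\sum_{i=1}^{d-1}\ell_i\ell_{i+1}(\ell_{i+1}-\ell_i)\] and \[i(C_{\ell,d}^{(2)})=\frac12\sum_{i=1}^{d-1}\ell_i\ell_{i+1}(\ell_{i+1}-\ell_i)+\ell_d+1.\]
   Context: The lattice volume $\mathrm{Vol}$ of a lattice polygon in $\mathbb{R}^2$ is $2!=2$ times its Euclidean area. Lattice points are the points of $\mathbb{Z}^2$ (including those on the boundary of the polygon). The polygon $C_{\ell,d}^{(2)}$ is the cyclic polygon whose vertices are given by the columns of the matrix with rows $(1,\dots,1)$, $(\ell_0,\dots,\ell_d)$, $(\ell_0^2,\dots,\ell_d^2)$, after dropping the first coordinate, which equals $1$. *)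

(* Defs.v *)
From HB Require Import structures.
From mathcomp Require Import all_boot all_order all_algebra.
From mathcomp Require Import all_classical all_reals all_analysis.
Import Order.TTheory GRing.Theory Num.Theory.
Import numFieldNormedType.Exports.

Set Implicit Arguments.
Unset Strict Implicit.
Unset Printing Implicit Defensive.

Local Open Scope classical_set_scope.
Local Open Scope ring_scope.

Definition convex_hull (R : realType) (M : lmodType R) (A : set M) : set M :=
  smallest (@convex_set R M) A.

Definition area (R : realType) (P : set (R^o * R^o)) : \bar R :=
  (lebesgue_measure \x lebesgue_measure)%E P.

(* 2! times the Euclidean area, as the standard simplex has area 1 / 2! *)
Definition lattice_volume (R : realType) (P : set (R^o * R^o)) : \bar R :=
  (2`!%:R%:E * area P)%E.

Definition lattice_points (R : realType) (P : set (R^o * R^o)) :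
  set (int * int) := [set z | P (z.1%:~R, z.2%:~R)].

(* [counting] takes the value +oo on infinite sets *)
Definition num_lattice_points (R : realType) (P : set (R^o * R^o)) : \bar R :=
  counting (lattice_points P).

(* Only the values l 0, ..., l d of the sequence l are used *)
Definition cyclic_polygon (R : realType) (l : nat -> int) (d : nat) :
    set (R^o * R^o) :=
  convex_hull [set ((l i)%:~R : R^o, (l i)%:~R ^+ 2 : R^o) | i in `I_d.+1].
Arguments cyclic_polygon : clear implicits.

(* Main.v *)
(* Over each interval [l i, l i.+1] the polygon is the region between the chord
   of the parabola through the vertices i and i.+1 and the chord through the
   vertices 0 and d. So the length of its vertical section is affine on each of
   these intervals, and the area follows by integrating it. Both chords have
   integer coefficients: at an integer abscissa the section has integer
   endpoints, hence one more lattice point than its length, and summing an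
   affine function over the integers of an interval amounts to the trapezoidal
   rule, which is exact. *)
Require Import Defs.
From HB Require Import structures.
From mathcomp Require Import all_boot all_order all_algebra.
From mathcomp Require Import all_classical all_reals all_analysis.
From mathcomp Require Import measurable_realfun ring lra zify.
Import Order.TTheory GRing.Theory Num.Theory.
Import numFieldNormedType.Exports.
Local Open Scope classical_set_scope.
Local Open Scope ring_scope.

(** * Convex sets and convex hulls in the plane *)

Lemma convex_conv (R : realType) (A : set (R^o * R^o))
    (x1 y1 x2 y2 t : R) :
  convex_set A -> A (x1, y1) -> A (x2, y2) -> 0 <= t -> t <= 1 ->
  A (t * x1 + (1 - t) * x2, t * y1 + (1 - t) * y2).
Proof.
move=> cA Au Av t0 t1.
have := cA (x1, y1) (x2, y2) (Itv01 t0 t1); rewrite !inE => /(_ Au Av).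
exact.
Qed.

Lemma convex_hull_convex (R : realType) (M : lmodType R) (A : set M) :
  convex_set (convex_hull A).
Proof.
move=> x y t; rewrite !inE => hx hy C [cC AC].
have := cC x y t; rewrite !inE; apply.
  exact: hx.
exact: hy.
Qed.

Lemma sub_convex_hull (R : realType) (M : lmodType R) (A : set M) :
  A `<=` convex_hull A.
Proof. exact: sub_gen_smallest. Qed.

Lemma convex_halfplane (R : realType) (a b c : R) :
  @convex_set R (R^o * R^o)%type [set v | a * v.1 + b * v.2 <= c].
Proof.
move=> u v t; rewrite !inE /= => hu hv.
rewrite /conv /= /unstable.onem /GRing.scale /=.
have : 0 <= t%:num by exact: ge0.
have : t%:num <= 1 by exact: le1.
move: t%:num => {}t t1 t0.
have h1 := ler_wpM2l t0 hu.
have h2 := ler_wpM2l (etrans (subr_ge0 _ _) t1) hv.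
lra.
Qed.

(* The line through (a, a^2) and (b, b^2). *)
Definition chord (K : pzRingType) (a b x : K) : K := (a + b) * x - a * b.
Arguments chord {K} a b x.

Lemma convex_chord (R : realType) (A : set (R^o * R^o)) (a b x : R) :
  convex_set A -> A (a, a ^+ 2) -> A (b, b ^+ 2) -> a < b -> a <= x <= b ->
  A (x, chord a b x).
Proof.
move=> cA Aa Ab ab /andP[ax xb].
have ba0 : 0 < b - a by rewrite subr_gt0.
have t0 : 0 <= (b - x) / (b - a) by rewrite divr_ge0 ?subr_ge0 // ltW.
have t1 : (b - x) / (b - a) <= 1 by rewrite ler_pdivrMr // mul1r lerD2l lerN2.
have := @convex_conv _ _ _ _ _ _ _ cA Aa Ab t0 t1.
rewrite /chord; congr A.
by congr pair; field; apply: lt0r_neq0.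
Qed.

Lemma convex_vertical (R : realType) (A : set (R^o * R^o)) (x y1 y2 y : R) :
  convex_set A -> A (x, y1) -> A (x, y2) -> y1 <= y <= y2 -> A (x, y).
Proof.
move=> cA A1 A2 /andP[y1y yy2].
(* The weight used below divides by [y2 - y1], so a segment reduced to a point is treated apart. *)
have [y12|y12] := eqVneq y1 y2.
  suff -> : y = y1 by [].
  by apply/eqP; rewrite eq_le y1y y12 yy2.
have d0 : 0 < y2 - y1 by rewrite subr_gt0 lt_neqAle y12 (le_trans y1y).
have t0 : 0 <= (y2 - y) / (y2 - y1).
  by apply: divr_ge0; [rewrite subr_ge0|exact: ltW].
have t1 : (y2 - y) / (y2 - y1) <= 1.
  by rewrite ler_pdivrMr // mul1r lerD2l lerN2.
have := @convex_conv _ _ _ _ _ _ _ cA A1 A2 t0 t1.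
congr A.
by congr pair; [ring|field; exact: lt0r_neq0].
Qed.

(** * Integrals of affine functions and finite counting *)

Lemma integral_affine (R : realType) (c e a b : R) : a <= b ->
  (\int[lebesgue_measure]_(x in `[a, b]) (c * x + e)%:E)%E =
  ((b - a) * (c * (a + b) / 2 + e))%:E.
Proof.
rewrite le_eqVlt => /orP[/eqP ->|ab].
  by rewrite set_itv1 integral_set1 subrr mul0r.
pose F : {poly R} := (c / 2) *: 'X^2 + e *: 'X.
have FE x : F^`().[x] = c * x + e.
  by rewrite derivD !derivZ derivXn derivX !hornerE /=; field.
under eq_integral do rewrite -FE.
rewrite (@continuous_FTC2 _ _ (horner F)) //.
- by rewrite -EFinB; congr EFin; rewrite !hornerE /=; field.
- by apply: continuous_subspaceT => x; apply: continuous_horner.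
- split; first by move=> x _; exact: derivable_horner.
  + by apply: cvg_at_right_filter; exact: continuous_horner.
  + by apply: cvg_at_left_filter; exact: continuous_horner.
- by move=> x _; rewrite derivE.
Qed.

Lemma counting_seq (R : realType) (T : choiceType) (s : seq T) : uniq s ->
  counting [set` s] = (size s)%:R%:E :> \bar R.
Proof.
move=> us; rewrite /counting asboolT; last exact: finite_seq.
congr (_%:R%:E); apply: card_fset_set.
case: s us => [|x0 s'] us; first by rewrite set_nil II0.
set s := x0 :: s' in us *.
have -> : [set` s] = nth x0 s @` `I_(size s).
  apply/seteqP; split => [x /(nthP x0)[i ? <-]|x [i ilt <-]]; first by exists i.
  exact: mem_nth.
apply: inj_card_eq => i j /set_mem /= ilt /set_mem /= jlt /eqP.
by rewrite nth_uniq // => /eqP.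
Qed.

(** Sweeping step of the lattice count: abscissae are integers, so going from [x] to [x + 1] adds a
    single column. *)
Lemma enum_add_column (A : set (int * int)) (x c h : int) (s : seq (int * int)) :
  0 <= h -> uniq s -> (forall z, z \in s <-> A z /\ z.1 <= x) ->
  (forall y, A (x + 1, y) <-> c <= y <= c + h) ->
  exists s' : seq (int * int), [/\ uniq s',
    forall z, z \in s' <-> A z /\ z.1 <= x + 1 &
    (size s')%:Z = (size s)%:Z + h + 1].
Proof.
move=> h0 us sA colA.
pose t := [seq (x + 1, c + j%:Z) | j <- iota 0 `|h|.+1].
have tE z : z \in t <-> z.1 = x + 1 /\ c <= z.2 <= c + h.
  split=> [/mapP[j]|[z1 zc]].
    by rewrite mem_iota => jh -> /=; split => //; lia.
  apply/mapP; exists `|z.2 - c|%N; first by rewrite mem_iota; lia.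
  by case: z z1 zc => z1 z2 /= -> zc; congr pair; lia.
exists (s ++ t); split.
- rewrite cat_uniq us map_inj_uniq ?iota_uniq ?andbT; last by move=> i j []; lia.
  by apply/hasPn => z /tE[z1 _]; apply/negP => /sA[_]; rewrite z1; lia.
- case=> z1 z2; rewrite mem_cat; split.
    case/orP => [/sA/= [Az zx]|/tE/= [-> zc]]; first by split => //; lia.
    by split; [apply/colA|].
  move=> [Az /= zx]; have [z1x|xz1] := leP z1 x.
    by apply/orP; left; apply/sA.
  have z1E : z1 = x + 1 by lia.
  by apply/orP; right; apply/tE; split => //=; apply/colA; rewrite -z1E.
- by rewrite size_cat size_map size_iota; lia.
Qed.

Lemma chord_intr (R : pzRingType) (a b x : int) :
  chord a%:~R b%:~R x%:~R = (chord a b x)%:~R :> R.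
Proof. by rewrite /chord rmorphB !rmorphM rmorphD. Qed.

(** * Edges and vertical sections of the polygon *)

Section CyclicPolygon.
Variables (R : realType) (d : nat) (l : nat -> int).
Hypotheses (d_ge1 : (1 <= d)%N) (l0 : l 0%N = 0).
Hypothesis l_incr : forall i : nat, (i < d)%N -> l i < l i.+1.

Local Notation P := (cyclic_polygon R l d).
Local Notation r i := ((l i)%:~R : R).

Lemma l_homo i j : (i <= j)%N -> (j <= d)%N -> l i <= l j.
Proof.
elim: j => [|j IH]; first by rewrite leqn0 => /eqP ->.
rewrite leq_eqVlt => /orP[/eqP ->//|ij] jd.
by apply: le_trans (ltW (l_incr j jd)); apply: IH => //; exact: ltnW.
Qed.

Lemma convex_cyclic_polygon : convex_set P.
Proof. exact: convex_hull_convex. Qed.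

Lemma cyclic_polygon_vertex i : (i <= d)%N -> P (r i, r i ^+ 2).
Proof. by move=> id; apply: sub_convex_hull; exists i. Qed.

(** A half-plane is convex, so it contains the hull as soon as it contains the vertices. *)
Lemma cyclic_polygon_halfplane (a b c : R) :
  (forall i, (i <= d)%N -> a * r i + b * r i ^+ 2 <= c) ->
  forall x y, P (x, y) -> a * x + b * y <= c.
Proof.
move=> vert x y; apply: (@smallest_sub _ _ _ [set v | a * v.1 + b * v.2 <= c]).
  exact: convex_halfplane.
by move=> _ [i /= id <-] /=; exact: vert.
Qed.

Lemma cyclic_polygon_range x y : P (x, y) -> 0 <= x <= r d.
Proof.
move=> Pxy; apply/andP; split.
  have := @cyclic_polygon_halfplane (-1) 0 0 _ x y Pxy.
  rewrite mul0r addr0 mulN1r oppr_le0; apply => i id.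
  by rewrite mul0r addr0 mulN1r oppr_le0 ler0z -l0 l_homo.
have := @cyclic_polygon_halfplane 1 0 (r d) _ x y Pxy.
rewrite mul0r addr0 mul1r; apply => i id.
by rewrite mul0r addr0 mul1r ler_int l_homo.
Qed.

Lemma cyclic_polygon_le x y : P (x, y) -> y <= chord 0 (r d) x.
Proof.
move=> Pxy; have := @cyclic_polygon_halfplane (- r d) 1 0 _ x y Pxy.
rewrite /chord => H.
suff : - r d * x + 1 * y <= 0 by lra.
apply: H => i id; have h0 : 0 <= r i by rewrite ler0z -l0 l_homo.
have h1 : r i <= r d by rewrite ler_int l_homo.
nra.
Qed.

(* No integer lies strictly between two consecutive vertices, so every vertex
   is on or above the line through them. *)
Lemma cyclic_polygon_ge i x y : (i < d)%N -> P (x, y) ->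
  chord (r i) (r i.+1) x <= y.
Proof.
move=> id Pxy.
have := @cyclic_polygon_halfplane (r i + r i.+1) (-1) (r i * r i.+1) _ x y Pxy.
rewrite /chord => H.
suff : (r i + r i.+1) * x + -1 * y <= r i * r i.+1 by lra.
apply: H => j jd.
suff : 0 <= (r j - r i) * (r j - r i.+1) by lra.
have [ji|ij] := leqP j i.
  apply: mulr_le0; rewrite subr_le0 ler_int.
    by apply: l_homo => //; exact: ltnW.
  by apply: l_homo => //; exact: leqW.
apply: mulr_ge0; rewrite subr_ge0 ler_int; apply: l_homo => //.
exact: ltnW.
Qed.

Lemma cyclic_polygon_lower_edge i x : (i < d)%N -> r i <= x <= r i.+1 ->
  P (x, chord (r i) (r i.+1) x).
Proof.
move=> id; apply: convex_chord.
- exact: convex_cyclic_polygon.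
- by apply: cyclic_polygon_vertex; exact: ltnW.
- exact: cyclic_polygon_vertex.
- by rewrite ltr_int l_incr.
Qed.

Lemma cyclic_polygon_upper_edge x : 0 <= x <= r d -> P (x, chord 0 (r d) x).
Proof.
have r0 : r 0 = 0 by rewrite l0.
rewrite -r0; apply: convex_chord.
- exact: convex_cyclic_polygon.
- exact: cyclic_polygon_vertex.
- exact: cyclic_polygon_vertex.
- rewrite ltr_int; apply: lt_le_trans (l_incr 0 d_ge1) _.
  exact: l_homo.
Qed.

Lemma cyclic_polygon_section i x y : (i < d)%N -> r i <= x <= r i.+1 ->
  P (x, y) <-> chord (r i) (r i.+1) x <= y <= chord 0 (r d) x.
Proof.
move=> id xi; split=> [Pxy|].
  by rewrite cyclic_polygon_ge // cyclic_polygon_le.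
apply: convex_vertical; first exact: convex_cyclic_polygon.
  exact: cyclic_polygon_lower_edge.
apply: cyclic_polygon_upper_edge.
(* The bounds on [x] follow from the lower edge point being in [P]. *)
apply: (cyclic_polygon_range _ (chord (r i) (r i.+1) x)).
exact: cyclic_polygon_lower_edge.
Qed.

Lemma lower_le_upper i x : (i < d)%N -> r i <= x <= r i.+1 ->
  chord (r i) (r i.+1) x <= chord 0 (r d) x.
Proof.
by move=> id xi; apply: cyclic_polygon_le; exact: cyclic_polygon_lower_edge.
Qed.

(* Twice the area of the part of the polygon with abscissae in [0, l m]. *)
Let dblarea m := l d * l m ^+ 2 - l m ^+ 3 +
  \sum_(0 <= i < m) l i * l i.+1 * (l i.+1 - l i).

(** Twice the area of a trapezoid: its width times the sum of its parallel sides, the section over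
    [l m] having length [l d * l m - l m ^+ 2]. *)
Let dblareaS m : dblarea m.+1 =
  dblarea m + (l m.+1 - l m) * (l d * (l m + l m.+1) - l m ^+ 2 - l m.+1 ^+ 2).
Proof. by rewrite /dblarea big_nat_recr //=; ring. Qed.

Let dblarea_d : dblarea d = \sum_(1 <= i < d) l i * l i.+1 * (l i.+1 - l i).
Proof. by rewrite /dblarea big_ltn // l0; ring. Qed.

(** * Area by integration of the section lengths *)

Let len (x : R) : \bar R := lebesgue_measure (xsection P x).

Let lenE i x : (i < d)%N -> r i <= x <= r i.+1 ->
  len x = ((r d - r i - r i.+1) * x + r i * r i.+1)%:E.
Proof.
move=> id xi; rewrite /len.
have -> : xsection P x = `[chord (r i) (r i.+1) x, chord 0 (r d) x]%classic.
  by apply/seteqP; split => y; rewrite /xsection /= inE in_itv /=;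
    move/(cyclic_polygon_section i x y id xi).
rewrite lebesgue_measure_itv /= lte_fin.
have := lower_le_upper i x id xi; rewrite le_eqVlt => /orP[/eqP eq|lt].
  (* When the section is a point, its measure is 0 and [eq] makes the affine formula vanish too. *)
  by rewrite eq ltxx; congr EFin; move: eq; rewrite /chord; lra.
by rewrite lt -EFinB; congr EFin; rewrite /chord; ring.
Qed.

(** Measurability is carried through the induction because additivity of the integral over a union
    requires it. *)
Let integral_len m : (m <= d)%N ->
  measurable_fun `[0, r m] len /\
  (\int[lebesgue_measure]_(x in `[0%R, r m]) len x = ((dblarea m)%:~R / 2)%:E)%E.
Proof.
elim: m => [_|m IH md].
  rewrite l0 set_itv1 integral_set1; split; first exact: measurable_fun_set1.
  by rewrite /dblarea big_geq // l0; congr EFin; ring.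
have [mlen ilen] := IH (ltnW md).
have rm0 : 0 <= r m by rewrite ler0z -l0 l_homo // ltnW.
have rmS : r m <= r m.+1 by rewrite ler_int l_homo.
pose f x := ((r d - r m - r m.+1) * x + r m * r m.+1)%:E.
have lenf : {in `[r m, r m.+1]%classic, f =1 len}.
  by move=> x; rewrite inE /= in_itv /= => xm; rewrite (lenE m).
have mf : measurable_fun `[r m, r m.+1] len.
  apply: eq_measurable_fun lenf _; apply/measurable_EFinP.
  by apply: measurable_funD => //; apply: measurable_funM.
(* The second piece is half-open to be disjoint from the first; its missing endpoint does not affect
   the integral. *)
have U : `[0, r m.+1]%classic = `[0, r m] `|` `]r m, r m.+1].
  by apply: itv_bndbnd_setU; rewrite bnd_simp.
have mfo : measurable_fun `]r m, r m.+1] len.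
  by apply: measurable_funS mf => //; apply: subset_itvr; rewrite bnd_simp.
have mU : measurable_fun `[0, r m.+1] len.
  by rewrite U; apply/measurable_funU.
split => //; rewrite U integral_setU //; last 2 first.
- by rewrite -U.
- rewrite disj_set2E; apply/eqP/seteqP; split => // x [] /=.
  rewrite !in_itv /= => /andP[_ h1] /andP[h2 _].
  by move: (lt_le_trans h2 h1); rewrite ltxx.
rewrite integral_itv_obnd_cbnd // ilen.
have -> : (\int[lebesgue_measure]_(x in `[r m, r m.+1]) len x =
    \int[lebesgue_measure]_(x in `[r m, r m.+1]) f x)%E.
  exact/esym/eq_integral.
rewrite /f integral_affine // -EFinD dblareaS; congr EFin.
move: (dblarea m) => D; rewrite rmorphD rmorphM !rmorphB !rmorphXn rmorphM rmorphD /=.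
by field.
Qed.

Lemma area_cyclic_polygon : area P =
  ((\sum_(1 <= i < d) l i * l i.+1 * (l i.+1 - l i))%:~R / 2)%:E.
Proof.
rewrite /area /product_measure1 /=.
have [_] := integral_len d (leqnn d); rewrite dblarea_d => <-.
(* The product measure integrates over the whole line, but sections outside [[0, r d]] are empty. *)
rewrite [RHS]integral_mkcond; apply: eq_integral => x _.
rewrite patchE; case: ifPn => // xd.
suff -> : xsection P x = set0 by rewrite measure0.
rewrite -subset0 => y; rewrite /xsection /= inE => /cyclic_polygon_range xr.
by apply: (negP xd); apply/mem_set; rewrite /= in_itv /= xr.
Qed.

(** * Lattice points, counted column by column *)

Let enum_upto x (s : seq (int * int)) :=
  uniq s /\ forall z, z \in s <-> lattice_points P z /\ z.1 <= x.

Let lattice_column i x y : (i < d)%N -> l i <= x <= l i.+1 ->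
  lattice_points P (x, y) <-> chord (l i) (l i.+1) x <= y <= chord 0 (l d) x.
Proof.
move=> id xi; rewrite /lattice_points /=.
rewrite (cyclic_polygon_section i) ?ler_int //.
by rewrite -[0]/(0%:~R) !chord_intr !ler_int.
Qed.

(** The column at [l i + j] has [l d * l i - l i ^+ 2 + (l d - l i - l i.+1) * j + 1] points; these
    are summed over [j] from 1 to [k], and doubled to stay in the integers. *)
Let enum_segment i k s : (i < d)%N -> l i + k%:Z <= l i.+1 ->
  enum_upto (l i) s -> exists2 s', enum_upto (l i + k%:Z) s' &
    2 * (size s')%:Z = 2 * (size s)%:Z + 2 * k%:Z * (l d * l i - l i ^+ 2 + 1)
      + (l d - l i - l i.+1) * k%:Z * (k%:Z + 1).
Proof.
move=> id + es; elim: k => [_|k IH kl].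
  by exists s; rewrite ?addr0 //; ring.
have [|s1 [us1 es1] size1] := IH; first by lia.
have xi : l i <= l i + k%:Z + 1 <= l i.+1 by lia.
pose x := l i + k%:Z + 1.
have h0 : 0 <= chord 0 (l d) x - chord (l i) (l i.+1) x.
  rewrite subr_ge0 -(ler_int R) -!chord_intr; apply: lower_le_upper => //.
  by rewrite !ler_int.
have [|s' [us' es' size']] :=
  enum_add_column _ _ (chord (l i) (l i.+1) x) _ _ h0 us1 es1.
  by move=> y; rewrite subrKC; exact: lattice_column.
exists s'.
  by rewrite -[k.+1]addn1 PoszD addrA.
rewrite size' !mulrDr size1 -[k.+1]addn1 PoszD /chord /x; ring.
Qed.

(** The trapezoidal rule gives the two end columns half weight, so the length over [l m] is added
    back (the one over 0 is zero); the [l m + 1] columns contribute one extra point each. *)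
Let enum_vertex m : (m <= d)%N -> exists2 s, enum_upto (l m) s &
  2 * (size s)%:Z = dblarea m + (l d * l m - l m ^+ 2) + 2 * l m + 2.
Proof.
elim: m => [_|m IH md].
  (* Starting from the empty list at abscissa -1 makes column 0, the single point at the origin, an
     ordinary sweeping step. *)
  have e0 : enum_upto (-1) [::].
    split=> // -[x y]; split => // -[/cyclic_polygon_range/andP[+ _]] /=.
    by rewrite ler0z => h1 h2; move: (le_trans h1 h2).
  have [us es] := e0.
  have [|s' [us' es' size']] :=
    enum_add_column _ _ 0 0 _ (lexx 0) us es.
    move=> y; rewrite addNr addr0 (lattice_column 0) //.
      by rewrite /chord l0 !mulr0 !mul0r !subr0.
    by rewrite l0 lexx -l0 l_homo.
  exists s'; first by rewrite l0; split.
  by rewrite size' /dblarea big_geq // l0 [size _]/=; ring.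
have [s es sizes] := IH (ltnW md).
have lm := l_homo m m.+1 (leqnSn m) md.
have kE : `|l m.+1 - l m|%N%:Z = l m.+1 - l m by rewrite gez0_abs // subr_ge0.
have [|s' es' size'] := enum_segment m `|l m.+1 - l m| s md _ es.
  by rewrite kE addrC subrK.
exists s'; first by move: es'; rewrite kE addrC subrK.
by rewrite size' sizes kE dblareaS; ring.
Qed.

Lemma num_lattice_points_cyclic_polygon : num_lattice_points P =
  (2^-1 * (\sum_(1 <= i < d) l i * l i.+1 * (l i.+1 - l i))%:~R
     + (l d)%:~R + 1)%:E.
Proof.
have [s [us es] sizes] := enum_vertex d (leqnn d).
rewrite /num_lattice_points.
(* Abscissae in [P] are at most [l d], so the list reached at the last vertex is complete. *)
have -> : lattice_points P = [set` s].
  apply/seteqP; split => [z Pz|z /= /es[]//].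
  apply/es; split => //.
  by have /andP[_] := cyclic_polygon_range _ _ Pz; rewrite ler_int.
rewrite counting_seq //; congr EFin.
move/(congr1 (fun k : int => k%:~R : R)): sizes.
rewrite dblarea_d expr2 subrr addr0 !rmorphD !rmorphM /= => sizes.
rewrite -[(size s)%:R]/((size s)%:Z%:~R); move: sizes. lra.
Qed.

End CyclicPolygon.

Theorem proposition3p1 (R : realType) (d : nat) (l : nat -> int)
    (d_ge1 : (1 <= d)%N)
    (l0 : l 0%N = 0)
    (l_incr : forall i : nat, (i < d)%N -> l i < l i.+1) :
  lattice_volume (cyclic_polygon R l d) =
    ((\sum_(1 <= i < d) l i * l i.+1 * (l i.+1 - l i))%:~R)%:E
  /\
  num_lattice_points (cyclic_polygon R l d) =
    (2^-1 * (\sum_(1 <= i < d) l i * l i.+1 * (l i.+1 - l i))%:~R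
     + (l d)%:~R + 1)%:E.
Proof.
split; last exact: num_lattice_points_cyclic_polygon.
rewrite /lattice_volume area_cyclic_polygon // -EFinM; congr EFin.
by rewrite mulrC mulfVK // pnatr_eq0.
Qed.
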